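(* For every complete metric space $X$ there is a poset $P$ such that $X$ is homeomorphic to $\mathrm{UF}(P)$ and $\mathrm{UF}(P)=\mathrm{MF}(P)$. Moreover, if $X$ is infinite, then for any dense subset $A$ of $X$ the poset $P$ may be taken to have the same cardinality as $A$.
   Context: A poset is a set $P$ with a reflexive, antisymmetric, transitive relation $\preceq$; $p\prec q$ means $p\preceq q$ and $p\neq q$. A filter on $P$ is a nonempty subset $F\subseteq P$ such that (1) for all $p,q\in F$ there is $r\in F$ with $r\preceq p$ and $r\preceq q$, and (2) if $p\in F$, $q\in P$ and $p\preceq q$ then $q\in F$. A filter $F$ is unbounded if there is no $r\in P$ with $r\prec q$ for every $q\in F$; it is maximal if no strictly larger filter contains it (every maximal filter is unbounded). $\mathrm{UF}(P)$ is the set of unbounded filters on $P$, with the topology having basis $\{N_p : p\in P\}$, where $N_p=\{F\in \mathrm{UF}(P) : p\in F\}$; $\mathrm{MF}(P)\subseteq \mathrm{UF}(P)$ is the set of maximal filters, with the subspace topology. *)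

(* Defs.v *)
From HB Require Import structures.
From mathcomp Require Import all_boot all_order all_algebra.
From mathcomp Require Import all_classical all_reals all_analysis.

Set Implicit Arguments.
Unset Strict Implicit.
Unset Printing Implicit Defensive.

Import Order.TTheory.

Local Open Scope classical_set_scope.
Local Open Scope order_scope.

Section PosetFilters.
Context {d : Order.disp_t} {P : porderType d}.
Implicit Types (F G : set P) (p q r : P).

Definition poset_filter F : Prop :=
  [/\ F !=set0,
      forall p q, F p -> F q -> exists r, [/\ F r, r <= p & r <= q] &
      forall p q, F p -> p <= q -> F q].

Definition unbounded_filter : set (set P) :=
  [set F | poset_filter F /\ ~ exists r, forall q, F q -> r < q].

Definition maximal_filter : set (set P) :=
  [set F | poset_filter F /\ forall G, poset_filter G -> ~ F `<` G].

End PosetFilters.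

Record UF (d : Order.disp_t) (P : porderType d) := MkUF {
  uf_set :> set P;
  uf_setP : unbounded_filter uf_set
}.

Section UFTopology.
Context {d : Order.disp_t} {P : porderType d}.

HB.instance Definition _ := gen_eqMixin (UF P).
HB.instance Definition _ := gen_choiceMixin (UF P).

Definition uf_nbhd (p : P) : set (UF P) := [set F : UF P | uf_set F p].

(* The factory isBaseTopological asks for a pointed index type; P may be empty,
   so the open sets are given directly as the unions of basic sets. *)
Definition uf_open (U : set (UF P)) : Prop :=
  exists D : set P, U = \bigcup_(p in D) uf_nbhd p.

Lemma uf_openP (U : set (UF P)) :
  uf_open U <->
  (forall F, U F -> exists p, uf_nbhd p F /\ uf_nbhd p `<=` U).
Proof.
split=> [[D ->] F [p Dp pF]|UP].
  by exists p; split=> // G pG; exists p.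
exists [set p | uf_nbhd p `<=` U]; apply/seteqP; split=> [F /UP[p [pF pU]]|F].
  by exists p.
by move=> [p pU pF]; exact: pU.
Qed.

Let uf_openT : uf_open setT.
Proof.
apply/uf_openP => F _; have [[[p Fp] _ _] _] := uf_setP F.
by exists p; split.
Qed.

Let uf_openI (U V : set (UF P)) : uf_open U -> uf_open V -> uf_open (U `&` V).
Proof.
move=> /uf_openP oU /uf_openP oV; apply/uf_openP => F [UF_ VF].
have [p [pF pU]] := oU _ UF_; have [q [qF qV]] := oV _ VF.
have [[_ dF _] _] := uf_setP F.
have [r [rF rp rq]] := dF _ _ pF qF.
exists r; split=> // G rG; have [[_ _ uG] _] := uf_setP G.
by split; [apply/pU/(uG r)|apply/qV/(uG r)].
Qed.

Let uf_open_bigU (I : Type) (f : I -> set (UF P)) :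
  (forall i, uf_open (f i)) -> uf_open (\bigcup_i f i).
Proof.
move=> of_; apply/uf_openP => F [i _ fiF].
have /uf_openP/(_ _ fiF)[p [pF pf]] := of_ i.
by exists p; split=> // G /pf fG; exists i.
Qed.

HB.instance Definition _ :=
  isOpenTopological.Build (UF P) uf_openT uf_openI uf_open_bigU.

End UFTopology.

Definition homeomorphic (X Y : topologicalType) : Prop :=
  exists (f : X -> Y) (g : Y -> X),
    [/\ cancel f g, cancel g f, continuous f & continuous g].

(* The library's completeType is pointed; this notion also covers the empty
   metric space. *)
Definition complete_metric (R : realType) (X : metricType R) : Prop :=
  forall u : nat -> X,
    cauchy (u @ \oo) -> exists x : X, u @ \oo --> x.

(* Main.v *)
Require Import Defs.
From HB Require Import structures.
From mathcomp Require Import all_boot all_order all_algebra.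
From mathcomp Require Import all_classical all_reals all_analysis.
From mathcomp Require Import lra.

(** The poset is that of formal balls [(a, r)] with centre [a] in the dense set
    and radius [r] among the [1/(n+1)], where [(a, r) < (b, s)] iff
    [d(a, b) + r < s].  In a filter, any two balls have a common refinement, so
    the centres of balls whose radii tend to the infimum [rho] of all radii form
    a Cauchy sequence; its limit [x] satisfies [d(b, x) <= s - rho] for every
    ball [(b, s)] of the filter.  If [rho > 0], then any small ball with centre
    close enough to [x] lies strictly below the whole filter.  Hence an
    unbounded filter has [rho = 0], and is then exactly
    [{(b, s) | d(b, x) < s}]. *)

Set Implicit Arguments.
Unset Strict Implicit.
Unset Printing Implicit Defensive.

Local Open Scope classical_set_scope.
Local Open Scope card_scope.

(** * Absorbing a countable factor in an infinite cardinal *)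

Lemma set_inj_card_le (T U : Type) (f : T -> U) :
  injective f -> [set: T] #<= [set: U].
Proof.
move=> f_inj; have : f @` [set: T] #= [set: T].
  by apply: inj_card_eq => x y _ _; exact: f_inj.
rewrite card_eq_le => /andP[_ /card_le_trans]; apply.
exact: subset_card_le.
Qed.

(* A maximal family [E] of injections [nat -> T] with disjoint ranges covers [T]
   up to a finite set, so [E * nat] surjects onto [T]; splitting [nat] as
   [nat * nat] then embeds [T * nat] into [T]. *)
Lemma card_setX_nat (T : eqType) :
  infinite_set [set: T] -> [set: T * nat] #= [set: T].
Proof.
move=> Tinf.
have [E [Einj Edisj Emax]] :=
  ex_maximal_disjoint_subcollection (fun u : nat -> T => range u) [set u | injective u].
pose C := ~` \bigcup_(u in E) range u.
have : finite_set C.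
  apply: contrapT => /infiniteP Cinf.
  have /card_leP[v] := Cinf.
  pose u n := val (v (to_setT n)).
  have Cu n : C (u n) by exact: set_valP.
  have u_inj : injective u.
    move=> m n /val_inj /(inj (mem_set I) (mem_set I)) /(congr1 val) //.
  have nEu : ~ E u by move=> Eu; apply: (Cu 0%N); exists u => //; exists 0%N.
  apply: (Emax (E `|` [set u])).
  - split=> [w Ew|sub]; first by left.
    by apply: nEu; apply: sub; right.
  - by move=> w [/Einj//|->].
  - move=> w w' [Ew|->] [Ew'|->]; rewrite //.
    + exact: Edisj.
    + move=> [x [[m _ <-] [n _ eqx]]].
      by case: (Cu n); rewrite eqx; exists w => //; exists m.
    + move=> [x [[m _ <-] [n _ eqx]]].
      by case: (Cu m); rewrite -eqx; exists w' => //; exists n.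
move=> Cfin; have /finite_seqP[s Cs] := Cfin.
have [u0 Eu0] : E !=set0.
  apply/set0P/eqP => E0; apply: Tinf; move: Cfin.
  by rewrite /C E0 bigcup_set0 setC0.
(* Parity separates two cases: index [2n] denotes the [n]-th term of the sequence, index [2n+1] the
   [n]-th entry of the leftover list [s], tagged with the arbitrary member [u0]. *)
have cover (x : T) : exists un : (nat -> T) * nat,
    E un.1 /\ x = if odd un.2 then nth (u0 0%N) s un.2./2 else un.1 un.2./2.
  have [Cx|/contrapT[u Eu [n _ <-]]] := pselect (C x).
    exists (u0, (index x s).*2.+1); split=> //=.
    rewrite odd_double /= uphalf_double nth_index //.
    by move: Cx; rewrite Cs.
  by exists (u, n.*2); rewrite /= odd_double doubleK.
have [c cP] := choice cover.
have [Ec eqc] : (forall x, E (c x).1) /\ (forall x, x = if odd (c x).2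
    then nth (u0 0%N) s (c x).2./2 else (c x).1 (c x).2./2).
  by split=> x; have [] := cP x.
apply/card_eqPle; split; last first.
  by apply: (@set_inj_card_le _ _ (fun x => (x, 0%N))) => x y [].
(* [f] keeps [(x, k)] in the range of [(c x).1]: disjointness recovers this sequence, and its
   injectivity the pickled pair. *)
pose f (p : T * nat) := (c p.1).1 (choice.pickle ((c p.1).2, p.2)).
apply: (@set_inj_card_le _ _ f); case=> [x k] [y l] fxy.
have eqc1 : (c x).1 = (c y).1.
  apply: Edisj; [exact: Ec|exact: Ec|].
  exists (f (x, k)); split; first by exists (choice.pickle ((c x).2, k)).
  by rewrite fxy; exists (choice.pickle ((c y).2, l)).
move: fxy; rewrite /f/= eqc1 => /(Einj _ (Ec y))/(pcan_inj choice.pickleK).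
by move=> [eqc2 ->]; rewrite (eqc x) (eqc y) eqc1 eqc2.
Qed.

(** * Filters in an arbitrary poset *)

Section MaximalUnbounded.
Local Open Scope order_scope.
Import Order.TTheory.
Context {d : Order.disp_t} {P : porderType d}.
Implicit Types (F : set P) (p : P).

(** The principal filter of a strict lower bound [r] would be strictly larger: [r] in [F] would give
    [r < r]. *)
Lemma maximal_filter_unbounded : @maximal_filter d P `<=` @unbounded_filter d P.
Proof.
move=> F [Ffilt Fmax]; split=> // -[r rF].
apply: (Fmax [set q | r <= q]); last first.
  split=> [q /rF/ltW//|sub].
  by have /rF := sub r (lexx r); rewrite ltxx.
split; first by exists r => /=.
- by move=> p q /= rp rq; exists r.
- by move=> p q /= rp pq; exact: le_trans pq.
Qed.

End MaximalUnbounded.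

(* The pair [(a, n)] stands for the formal ball of centre [a] and radius
   [1/(n+1)]. *)
Definition formal_ball (R : realType) (X : metricType R) (A : set X) : Type :=
  (A * nat)%type.

HB.instance Definition _ (R : realType) (X : metricType R) (A : set X) :=
  Choice.on (formal_ball A).

(** * Formal balls and the filters of points *)

Section FormalBall.
Local Open Scope ring_scope.
Import Order.TTheory GRing.Theory Num.Theory.
Context {R : realType} {X : metricType R} {A : set X}.
Implicit Types (p q r : formal_ball A) (x y : X).

Definition center p : X := val p.1.
Definition radius p : R := p.2.+1%:R^-1.

Lemma radius_gt0 p : 0 < radius p.
Proof. by rewrite invr_gt0. Qed.

Definition ball_lt p q := mdist (center p) (center q) + radius p < radius q.

Lemma ball_lt_irr : irreflexive ball_lt.
Proof. by move=> p; rewrite /ball_lt mdistxx add0r ltxx. Qed.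

Lemma ball_lt_trans : transitive ball_lt.
Proof.
move=> q p r; rewrite /ball_lt => pq qr.
by have := metric_triangle (center p) (center q) (center r); lra.
Qed.

HB.instance Definition _ := Order.Lt_isPOrder.Build Order.default_display
  (formal_ball A) ball_lt_irr ball_lt_trans.

Lemma formal_ball_ltE p q :
  (p < q)%O = (mdist (center p) (center q) + radius p < radius q).
Proof. by []. Qed.

(** Only an implication: distinct balls attaining equality are incomparable. *)
Lemma formal_ball_le p q :
  (p <= q)%O -> mdist (center p) (center q) + radius p <= radius q.
Proof.
rewrite le_eqVlt => /predU1P[->|]; first by rewrite mdistxx add0r.
by rewrite formal_ball_ltE => /ltW.
Qed.

Definition point_filter x : set (formal_ball A) :=
  [set p | mdist (center p) x < radius p].

Lemma small_formal_ball (A_dense : dense A) x (e : R) : 0 < e ->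
  exists2 p, point_filter x p & radius p < e.
Proof.
move=> e0; have [n _ /(_ n (leqnn n)) /= ne] := near_infty_natSinv_lt (PosNum e0).
have n0 : 0 < n.+1%:R^-1 :> R by rewrite invr_gt0.
have [||a [/interior_subset + Aa]] := A_dense (ball x n.+1%:R^-1)°.
- by exists x; exact: nbhsx_ballx.
- exact: open_interior.
rewrite ballEmdist /= => xa.
exists (SigSub (mem_set Aa), n) => //.
by rewrite /point_filter/= /center/radius/= metric_sym.
Qed.

Lemma point_filter_filter (A_dense : dense A) x : poset_filter (point_filter x).
Proof.
split.
- by have [p xp _] := small_formal_ball A_dense x ltr01; exists p.
- move=> p q xp xq.
  (* [e] is the smaller slack of [x] in the two balls; a ball around [x] of radius below [e / 2]
     uses less than [e] of it. *)
  pose e := Num.min (radius p - mdist (center p) x) (radius q - mdist (center q) x).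
  have [|r xr re] := @small_formal_ball A_dense x (e / 2).
    by rewrite divr_gt0// lt_min !subr_gt0; apply/andP.
  have [ep eq] : e <= radius p - mdist (center p) x /\
                 e <= radius q - mdist (center q) x.
    by split; rewrite /e ge_min lexx ?orbT.
  exists r; split=> //; apply: ltW; rewrite formal_ball_ltE.
  + have := metric_triangle (center r) x (center p).
    rewrite (metric_sym x); move: xr; rewrite /point_filter/=; lra.
  + have := metric_triangle (center r) x (center q).
    rewrite (metric_sym x); move: xr; rewrite /point_filter/=; lra.
- move=> p q + /formal_ball_le pq; rewrite /point_filter/= => xp.
  have := metric_triangle (center q) (center p) x.
  rewrite (metric_sym (center q) (center p)); lra.
Qed.

(** A ball of radius below [e / 2] containing [x] also contains [y]. Assuming mere inclusion makes
    filters of distinct points incomparable, which yields maximality. *)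
Lemma point_filter_inj (A_dense : dense A) x y :
  point_filter x `<=` point_filter y -> x = y.
Proof.
move=> xy; apply/mdist_positivity/eqP; rewrite eq_le mdist_ge0 andbT.
apply/ler_addgt0Pl => e e0; rewrite addr0.
have [|p xp pe] := @small_formal_ball A_dense x (e / 2); first by rewrite divr_gt0.
have := xy _ xp; move: xp; rewrite /point_filter/= => xp yp.
have := metric_triangle x (center p) y.
rewrite (metric_sym x (center p)); lra.
Qed.

Lemma filter_radius_lower_bound (F : set (formal_ball A)) :
  (exists r, forall q, F q -> (r < q)%O) ->
  exists2 e : R, 0 < e & forall q, F q -> e < radius q.
Proof.
move=> [r rF]; exists (radius r); first exact: radius_gt0.
move=> q /rF; rewrite formal_ball_ltE.
by have := mdist_ge0 (center r) (center q); lra.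
Qed.

Lemma small_filter_unbounded (F : set (formal_ball A)) : poset_filter F ->
  (forall e, 0 < e -> exists2 p, F p & radius p < e) -> unbounded_filter F.
Proof.
move=> Ffilt Fsmall; split=> // /filter_radius_lower_bound[e e0 eF].
by have [p /eF + /lt_trans pe] := Fsmall _ e0 => /pe; rewrite ltxx.
Qed.

Lemma point_filter_unbounded (A_dense : dense A) x :
  unbounded_filter (point_filter x).
Proof.
apply: small_filter_unbounded; first exact: point_filter_filter.
by move=> e e0; exact: small_formal_ball.
Qed.

(** * Limits of filters in a complete space *)

Lemma filter_limit (X_complete : complete_metric X) (F : set (formal_ball A)) :
  poset_filter F -> exists x (rho : R),
    [/\ 0 <= rho, forall p, F p -> mdist (center p) x <= radius p - rho &
        forall e, 0 < e -> exists2 p, F p & radius p < rho + e].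
Proof.
move=> [[p0 Fp0] Fdir Fup].
pose rho := inf [set radius p | p in F].
have lbF : lbound [set radius p | p in F] (0 : R).
  by move=> _ [p _ <-]; rewrite ltW// radius_gt0.
have rho_le p : F p -> rho <= radius p.
  by move=> Fp; apply: ge_inf; [exists 0|exists p].
have Fsmall e : 0 < e -> exists2 p, F p & radius p < rho + e.
  move=> e0; have [|_ [p Fp <-] pe] := @inf_adherent _ [set radius p | p in F] _ e0.
    by split; [exists (radius p0), p0|exists 0].
  by exists p.
(* For a common refinement [r], the distance is at most [(radius p - radius r) + (radius q - radius
   r)], and [radius r >= rho]. *)
have dist_le p q : F p -> F q ->
    mdist (center p) (center q) <= radius p + radius q - 2 * rho.
  move=> Fp Fq; have [r [Fr /formal_ball_le rp /formal_ball_le rq]] := Fdir _ _ Fp Fq.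
  have := metric_triangle (center p) (center r) (center q).
  rewrite (metric_sym (center p) (center r)); have := rho_le _ Fr; lra.
have Fn n : exists p, F p /\ radius p < rho + n.+1%:R^-1.
  by have [|p Fp pn] := Fsmall n.+1%:R^-1; [rewrite invr_gt0|exists p].
have [u uP] := choice Fn.
have u_small e : 0 < e -> \forall n \near \oo, radius (u n) < rho + e.
  move=> e0; apply: filterS (near_infty_natSinv_lt (PosNum e0)) => n ne.
  by apply: lt_trans (uP n).2 _; rewrite ltrD2l.
have [|x ux] := X_complete (center \o u).
  apply: cauchy_exP => e e0.
  have e20 : 0 < e / 2 by rewrite divr_gt0.
  have [n _ /(_ n (leqnn n)) /= un] := u_small _ e20.
  exists (center (u n)); rewrite ballEmdist /=.
  apply: filterS (u_small _ e20) => m um /=.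
  by have := dist_le _ _ (uP n).1 (uP m).1; lra.
exists x, rho; split=> //.
  by apply: lb_le_inf => //; exists (radius p0), p0.
move=> p Fp; apply/ler_addgt0Pl => e e0.
have e20 : 0 < e / 2 by rewrite divr_gt0.
have /metricType_numDomainType.cvgrPdist_lt/(_ _ e20) u_close := ux.
near \oo => n.
have un : radius (u n) < rho + e / 2 by near: n; exact: u_small.
have xn : mdist x (center (u n)) < e / 2 by near: n; exact: u_close.
have := dist_le _ _ Fp (uP n).1.
have := metric_triangle (center p) (center (u n)) x.
rewrite (metric_sym (center (u n)) x); lra.
Unshelve. all: by end_near. Qed.

Lemma unbounded_filterE (X_complete : complete_metric X) (A_dense : dense A)
    (F : set (formal_ball A)) :
  unbounded_filter F -> exists x, F = point_filter x.
Proof.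
move=> [Ffilt Funb].
have [x [rho [rho_ge0 xF Fsmall]]] := filter_limit X_complete Ffilt.
have [_ Fdir Fup] := Ffilt.
have rho0 : rho = 0.
  apply/eqP; rewrite eq_le rho_ge0 andbT leNgt; apply/negP => rho_gt0.
  apply: Funb.
  have [|p xp prho] := @small_formal_ball A_dense x (rho / 2).
    by rewrite divr_gt0.
  (* Both [radius p] and the distance from [center p] to [x] are below [rho / 2], so the margin
     [rho] in [xq] absorbs their sum. *)
  exists p => q /xF xq; rewrite formal_ball_ltE.
  have := metric_triangle (center p) x (center q).
  rewrite (metric_sym x); move: xp; rewrite /point_filter/=; lra.
move: xF Fsmall; rewrite {}rho0 => xF Fsmall.
exists x; apply/seteqP; split=> p.
(* Taking [q] of radius smaller than that of [p] forces the common refinement [r] to differ from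
   [p], hence to lie strictly below it. *)
- move=> Fp; have [q Fq qp] := Fsmall _ (radius_gt0 p).
  have [r [Fr rp /formal_ball_le rq]] := Fdir _ _ Fp Fq.
  have {rp} : (r < p)%O.
    rewrite lt_neqAle rp andbT; apply/eqP => eq_rp.
    by have := mdist_ge0 (center r) (center q); rewrite eq_rp in rq *; lra.
  rewrite formal_ball_ltE /point_filter/= => rp.
  have := metric_triangle (center p) (center r) x.
  by rewrite (metric_sym (center p) (center r)); have := xF _ Fr; lra.
- rewrite /point_filter/= => xp.
  (* Half the slack suffices: [radius q] bounds the distance from [center q] to [x] and is counted
     once more in [q < p]. *)
  have [|q Fq qp] := Fsmall ((radius p - mdist (center p) x) / 2).
    by rewrite divr_gt0// subr_gt0.
  apply: (Fup q) => //; apply: ltW; rewrite formal_ball_ltE.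
  have := metric_triangle (center q) x (center p).
  by rewrite (metric_sym x); have := xF _ Fq; lra.
Qed.

(** A filter containing a point filter inherits its arbitrarily small radii, so it is unbounded and
    again a point filter. *)
Lemma unbounded_formal_ball_maximal (X_complete : complete_metric X)
    (A_dense : dense A) :
  @unbounded_filter _ (formal_ball A) = @maximal_filter _ (formal_ball A).
Proof.
apply/seteqP; split=> [F Funb|]; last exact: maximal_filter_unbounded.
split=> [|G Gfilt [FG]]; first by have [] := Funb.
have [x Fx] := unbounded_filterE X_complete A_dense Funb.
have [|y Gy] := @unbounded_filterE X_complete A_dense G.
  apply: small_filter_unbounded => // e e0.
  have [p xp pe] := small_formal_ball A_dense x e0.
  by exists p => //; apply: FG; rewrite Fx.
apply; suff -> : F = G by [].
by rewrite Fx Gy (@point_filter_inj A_dense x y)// -Fx -Gy.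
Qed.

(** * The homeomorphism with the space of unbounded filters *)

Lemma homeomorphic_UF_formal_ball (X_complete : complete_metric X)
    (A_dense : dense A) :
  homeomorphic X (UF (formal_ball A)).
Proof.
pose f x := MkUF (point_filter_unbounded A_dense x).
have [g gP] := choice (fun F : UF (formal_ball A) =>
  unbounded_filterE X_complete A_dense (uf_setP F)).
have gK : cancel g f.
  move=> [F Funb]; have /= := gP (MkUF Funb); rewrite /f.
  move: (g _) => x Fx; move: (point_filter_unbounded _ _); rewrite -Fx => Funb'.
  by congr MkUF; exact: Prop_irrelevance.
have fK : cancel f g.
  by move=> x; symmetry; apply: point_filter_inj => //; rewrite -gP.
exists f, g; split=> //.
(* The preimage of [uf_nbhd p] is the open ball that [p] names. *)
- apply/continuousP => U [D ->]; rewrite preimage_bigcup.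
  apply: bigcup_open => p _.
  rewrite openE => x /= xp; apply/nbhs_ballP.
  exists (radius p - mdist (center p) x); first by rewrite /= subr_gt0.
  move=> y; rewrite ballEmdist /= /uf_nbhd/= /point_filter/= => xy.
  by have := metric_triangle (center p) x y; lra.
(* Two points in a common ball of radius below [e / 2] are less than [e] apart. *)
- apply/continuousP => U oU; apply/uf_openP => F UgF.
  have /nbhs_ballP[e /= e0 eU] : nbhs (g F) U by exact: open_nbhs_nbhs.
  have [|p gFp pe] := @small_formal_ball A_dense (g F) (e / 2).
    by rewrite divr_gt0.
  exists p; split=> [|G]; rewrite /uf_nbhd/= gP // => gGp.
  apply: eU; rewrite ballEmdist/=.
  have := metric_triangle (g F) (center p) (g G).
  rewrite (metric_sym (g F) (center p)).
  by move: gFp gGp; rewrite /point_filter/=; lra.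
Qed.

End FormalBall.

Theorem theorem2p3 (R : realType) (X : metricType R)
    (X_complete : complete_metric X) :
  (exists (d : Order.disp_t) (P : porderType d),
      homeomorphic X (UF P) /\
      @unbounded_filter d P = @maximal_filter d P) /\
  (infinite_set [set: X] ->
   forall A : set X, dense A ->
   exists (d : Order.disp_t) (P : porderType d),
     [/\ homeomorphic X (UF P),
         @unbounded_filter d P = @maximal_filter d P &
         [set: P] #= A]).
Proof.
split=> [|X_inf A A_dense].
  have T_dense : dense [set: X] by move=> U U0 _; rewrite setIT.
  exists _, (formal_ball [set: X]); split.
    exact: homeomorphic_UF_formal_ball.
  exact: unbounded_formal_ball_maximal.
exists _, (formal_ball A); split.
- exact: homeomorphic_UF_formal_ball.
- exact: unbounded_formal_ball_maximal.
(* A finite [A] would be closed, and being dense it would be all of [X]. *)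
- have A_inf : infinite_set A.
    move=> A_fin; apply: X_inf; apply: (sub_finite_set _ A_fin) => x _.
    have A_closed : closed A.
      apply: accessible_finite_set_closed.1 A_fin.
      exact/hausdorff_accessible/metric_hausdorff.
    apply: contrapT => nAx.
    have [||y [] //] := A_dense (~` A); first by exists x.
    exact: closed_openC.
  apply: card_eq_trans (card_setT A); apply: card_setX_nat.
  by rewrite (eq_finite_set (card_setT A)).
Qed.
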